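(* Let $u$ (with pressure $p$) be a solution of the weak formulation of the Navier–Stokes equations recalled in the context, let $t_k=k\Delta t$ ($k=0,\dots,K$, $K\Delta t=T$), and let $u_k=u(\cdot,t_k)\in X$ with $\Delta u_k\in L^2(\Omega)$. Let $X^r$ be the POD space of dimension $r\le R$, with $L^2$ projection $P^r$, POD eigenvalues $\lambda_j$, POD modes $\varphi_j$ and ROM stiffness matrix $S^r$. Assume that for all $k$ $$\|u_k-P^r(u_k)\|^2\le C\Big(h^{2m+4}+\Delta t^4+\sum_{j=r+1}^R\lambda_j\Big),$$ $$\|\nabla(u_k-P^r(u_k))\|^2\le C\Big(h^{2m+2}+\|S^r\|_2h^{2m+4}+(1+\|S^r\|_2)\Delta t^4+\sum_{j=r+1}^R\|\nabla\varphi_j\|^2\lambda_j\Big),$$ with a constant $C$ independent of $h,m,\Delta t,r$ and the $\lambda_j$. Let $\delta>0$ be the filter radius, let $N\ge 0$ be an integer, let $\overline{u_k}=F^r u_k$ be the ROM differential filter of $u_k$, and let $D_N^r$ be the ROM van Cittert approximate deconvolution operator. Then there is a constant $C(N)$, depending on $N$ (and on the constant $C$ above and the problem data) but not on $h,m,\Delta t,r,\delta$ or the $\lambda_j$, such that for all $k$ $$\begin{aligned}\|u_k-D_N^r\overline{u_k}\|^2\le{}& C(N)\Big(h^{2m+4}+\Delta t^4+\sum_{j=r+1}^R\lambda_j\Big)\\&+C(N)\,\delta^2\Big(h^{2m+2}+\|S^r\|_2h^{2m+4}+(1+\|S^r\|_2)\Delta t^4+\sum_{j=r+1}^R\|\nabla\varphi_j\|^2\lambda_j\Big)\\&+C(N)\,\delta^4\|\Delta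 u_k\|^2.\end{aligned}$$
   Context: Setting. $\Omega\subset\mathbb R^d$ ($d=2,3$) is a bounded domain, $T>0$, $\|\cdot\|$ and $(\cdot,\cdot)$ are the $L^2(\Omega)$ norm and inner product, $X=H_0^1(\Omega;\mathbb R^d)$, $Q=L_0^2(\Omega)$ (mean-zero $L^2$ functions). The weak Navier–Stokes problem with viscosity $\nu>0$ and forcing $f$ is: find $u\in X$, $p\in Q$ such that, for times in $(0,T]$, $\int_\Omega \partial_t u\cdot v\,dx+\nu(\nabla u,\nabla v)+((u\cdot\nabla)u,v)-(\nabla\cdot v,p)=(f,v)$ for all $v\in X$, and $(\nabla\cdot u,q)=0$ for all $q\in Q$. Finite elements. $X^h\subset X$ and $Q^h\subset Q$ are Taylor–Hood finite element spaces of piecewise polynomials of order $m+1$ and $m$ ($m\ge1$) on a mesh of size $h$; $\Delta t$ is the time step; $u_k^h\in X^h$ ($k=0,\dots,K$) are finite element velocity approximations of $u_k$. POD space. From the snapshots $u_0^h,\dots,u_K^h$ form the correlation matrix $\mathcal C_{k\ell}=\frac1{K+1}(u_k^h,u_\ell^h)$ of rank $R$, with positive eigenvalues $\lambda_1\ge\dots\ge\lambda_R>0$; $\varphi_1,\dots,\varphi_R\in X^h$ are the corresponding $L^2$-orthonormal POD modes, i.e. the $L^2$-orthonormal eigenfunctions of $w\mapsto\frac1{K+1}\sum_k (w,u_k^h)u_k^h$ with eigenvalues $\lambda_j$. For $r\le R$, $X^r=\mathrm{span}\{\varphi_1,\dots,\varphi_r\}\subset X^h\subset X$. The ROM stiffness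 matrix is $S^r\in\mathbb R^{r\times r}$, $S^r_{ij}=(\nabla\varphi_i,\nabla\varphi_j)$, and $\|S^r\|_2$ is its spectral norm. The ROM projection $P^r(w)\in X^r$ of $w\in L^2(\Omega;\mathbb R^d)$ is defined by $(P^r(w),v^r)=(w,v^r)$ for all $v^r\in X^r$. ROM differential filter. For $\delta>0$ and $\phi\in L^2(\Omega;\mathbb R^d)$, $\overline\phi=F^r\phi\in X^r$ is the unique solution of $\delta^2(\nabla\overline\phi,\nabla v^r)+(\overline\phi,v^r)=(\phi,v^r)$ for all $v^r\in X^r$. ROM van Cittert operator. $D_N^r\phi=\sum_{n=0}^N(I-F^r)^n\phi$; it is applied here to elements of $X^r$, which it maps to $X^r$. *)

(* Defs.v *)
From HB Require Import structures.
From mathcomp Require Import all_boot all_order all_algebra.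
From mathcomp Require Import all_classical all_reals all_analysis.
From mathcomp Require mpoly.
Set Implicit Arguments.
Unset Strict Implicit.
Unset Printing Implicit Defensive.
Import Order.TTheory GRing.Theory Num.Theory.
Import numFieldNormedType.Exports.
Local Open Scope classical_set_scope.
Local Open Scope ring_scope.

(* The product (= Borel) sigma-algebra on R^n. *)
Section measurable_rV.
Variables (R : realType) (n : nat).

Let coord (i : 'I_n) (x : 'rV[R]_n) : R := x 0 i.

Let rV_set0 : g_sigma_preimage coord set0.
Proof. exact: sigma_algebra0. Qed.

Let rV_setC A : g_sigma_preimage coord A -> g_sigma_preimage coord (~` A).
Proof. exact: sigma_algebraC. Qed.

Let rV_bigcup (F : (set 'rV[R]_n)^nat) :
  (forall i, g_sigma_preimage coord (F i)) ->
  g_sigma_preimage coord (\bigcup_i F i).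
Proof. exact: sigma_algebra_bigcup. Qed.

HB.instance Definition _ := @isMeasurable.Build default_measure_display
  'rV[R]_n (g_sigma_preimage coord) rV_set0 rV_setC rV_bigcup.

Lemma measurable_fun_rV (d : measure_display) (T : measurableType d)
    (f : T -> 'rV[R]_n) :
  (forall i, measurable_fun [set: T] (fun x => f x 0 i)) ->
  measurable_fun [set: T] f.
Proof.
move=> mf _ A mA; rewrite setTI.
suff : g_sigma_preimage (fun i => coord i \o f) `<=` measurable.
  by apply; rewrite g_sigma_preimage_comp; exists A => //; rewrite setTI.
apply: smallest_sub; first exact: sigma_algebra_measurable.
move=> B; rewrite -bigcup_seq /= => -[i _ [C mC <-]].
exact: mf.
Qed.

Lemma measurable_coord (i : 'I_n) :
  measurable_fun [set: 'rV[R]_n] (fun x : 'rV[R]_n => x 0 i).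
Proof.
move=> _ B mB; apply: sub_sigma_algebra; rewrite -bigcup_seq /=.
by exists i; rewrite /= ?mem_index_enum//; exists B.
Qed.

End measurable_rV.

Section lebesgue_rV.
Variable R : realType.

Definition rV_cons n (p : measurableTypeR R * 'rV[R]_n) : 'rV[R]_n.+1 :=
  \row_i (if unlift ord0 i is Some j then p.2 0 j else p.1).

Definition rV_uncons n (x : 'rV[R]_n.+1) : measurableTypeR R * 'rV[R]_n :=
  (x 0 0, \row_j x 0 (lift ord0 j)).

Lemma rV_consK n : cancel (@rV_cons n) (@rV_uncons n).
Proof.
move=> [a x]; rewrite /rV_uncons; congr pair.
  by rewrite mxE unlift_none.
by apply/rowP => j; rewrite !mxE liftK.
Qed.

Lemma measurable_rV_cons n : measurable_fun setT (@rV_cons n).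
Proof.
apply: measurable_fun_rV => i.
case: (unliftP ord0 i) => [j|] ->.
  under eq_fun do rewrite mxE liftK.
  exact: measurableT_comp (measurable_coord j) measurable_snd.
under eq_fun do rewrite mxE unlift_none.
exact: measurable_fst.
Qed.

Lemma measurable_rV_uncons n : measurable_fun setT (@rV_uncons n).
Proof.
apply: measurable_fun_pair; first exact: measurable_coord.
apply: measurable_fun_rV => j; under eq_fun do rewrite mxE.
exact: measurable_coord.
Qed.



Section step.
Variables (n : nat) (mu : {sigma_finite_measure set 'rV[R]_n -> \bar R}).

Let mcons : measurable_fun setT (@rV_cons n) := @measurable_rV_cons n.

Definition lebesgue_step : set 'rV[R]_n.+1 -> \bar R :=
  pushforward (@lebesgue_measure R \x mu)%E (@rV_cons n).

Let step0 : lebesgue_step set0 = 0%E.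
Proof. by rewrite /lebesgue_step /pushforward preimage_set0 measure0. Qed.

Let step_ge0 A : (0 <= lebesgue_step A)%E.
Proof. exact: (measure_ge0 (@lebesgue_measure R \x mu)%E). Qed.

Let step_sigma_additive : semi_sigma_additive lebesgue_step.
Proof.
move=> F mF tF mUF; rewrite /lebesgue_step /pushforward preimage_bigcup.
apply: measure_semi_sigma_additive.
- by move=> k; rewrite -[X in measurable X]setTI; exact: mcons.
- apply/trivIsetP => i j _ _ ij; rewrite -preimage_setI.
  by move/trivIsetP : tF => /(_ _ _ _ _ ij) -> //; rewrite preimage_set0.
- by rewrite -preimage_bigcup -[X in measurable X]setTI; exact: mcons.
Qed.

HB.instance Definition _ := isMeasure.Build _ _ _ lebesgue_step
  step0 step_ge0 step_sigma_additive.

Let step_sigma_finite : sigma_finite setT lebesgue_step.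
Proof.
have /sigma_finiteP[F [TF ndF Foo]] := sigma_finiteT (@lebesgue_measure R).
have /sigma_finiteP[G [TG ndG Goo]] := sigma_finiteT mu.
exists (fun k => @rV_uncons n @^-1` (F k `*` G k)).
  rewrite -preimage_bigcup (_ : \bigcup_k _ = setT) ?preimage_setT//.
  rewrite -subTset => -[x y] _.
  have [k _ Fkx] : (\bigcup_k F k) x by rewrite -TF.
  have [l _ Gly] : (\bigcup_k G k) y by rewrite -TG.
  exists (maxn k l) => //; split.
    by move: x Fkx; exact/subsetPset/ndF/leq_maxl.
  by move: y Gly; exact/subsetPset/ndG/leq_maxr.
move=> k; have [mFk Fk] := Foo k; have [mGk Gk] := Goo k; split.
  rewrite -[X in measurable X]setTI; apply: measurable_rV_uncons => //.
  exact: measurableX.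
rewrite /lebesgue_step /pushforward -comp_preimage.
rewrite (_ : _ \o _ = id); last by apply/funext => p; exact: rV_consK.
rewrite preimage_id product_measure1E//.
by rewrite lte_mul_pinfty// ge0_fin_numE.
Qed.

HB.instance Definition _ := Measure_isSigmaFinite.Build _ _ _ lebesgue_step
  step_sigma_finite.

End step.

(* n-dimensional Lebesgue measure, as an iterated product measure. *)
Fixpoint lebesgue_rV n : {sigma_finite_measure set 'rV[R]_n -> \bar R} :=
  match n with
  | 0 => dirac (0 : 'rV[R]_0)
  | n'.+1 => lebesgue_step (lebesgue_rV n')
  end.

Lemma lebesgue_rV_box n (a b : 'rV[R]_n) : (forall i, a 0 i <= b 0 i) ->
  lebesgue_rV n [set x : 'rV[R]_n | forall i, a 0 i <= x 0 i <= b 0 i] =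
  (\prod_i (b 0 i - a 0 i))%:E.
Proof.
elim: n => [|n IHn] in a b *.
  move=> _; rewrite big_ord0 /= diracE (_ : _ \in _ = true)//.
  by apply/mem_set => -[].
move=> ab; rewrite /= /lebesgue_step /pushforward.
pose tl (x : 'rV[R]_n.+1) := \row_j x 0 (lift ord0 j).
have := IHn (tl a) (tl b); set B := [set x : 'rV[R]_n | _] => IHab.
have mB : measurable B.
  rewrite (_ : B = \bigcap_(i in setT) ((fun x : 'rV[R]_n => x 0 i) @^-1`
      `[tl a 0 i, tl b 0 i]%classic)).
    apply: fin_bigcap_measurable => // i _.
    rewrite -[X in measurable X]setTI; apply: measurable_coord => //.
  apply/seteqP; split => x /= Bx i.
    by move=> _ /=; rewrite in_itv /=; exact: Bx.
  by have := Bx i I; rewrite /= in_itv.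
rewrite (_ : _ @^-1` _ = `[a 0 0, b 0 0]%classic `*` B); last first.
  apply/seteqP; split => -[y x] /=; rewrite in_itv /=.
    move=> yx; split; first by have := yx 0; rewrite !mxE unlift_none.
    by move=> j; have := yx (lift ord0 j); rewrite !mxE liftK.
  move=> [ay Bx] i; rewrite mxE; case: (unliftP ord0 i) => [j|] -> //=.
  by have := Bx j; rewrite !mxE.
rewrite product_measure1E// IHab => [|j]; last by rewrite !mxE.
rewrite /= lebesgue_measure_itv/= lte_fin big_ord_recl EFinM; congr (_ * _)%E.
  by case: ltgtP (ab 0) => // -> _; rewrite subrr.
by congr _%:E; apply: eq_bigr => j _; rewrite !mxE.
Qed.

End lebesgue_rV.

Section lebesgue_space.
Context {R : realType} {d : nat}.
Implicit Type Om : set 'rV[R]_d.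

Definition is_L2_scalar Om (q : 'rV[R]_d -> R) : Prop :=
  (q \_ Om) \in Lfun (lebesgue_rV R d) 2%:E.

(* Row vectors are the case m = 1. *)
Definition is_L2 {m n : nat} Om (F : 'rV[R]_d -> 'M[R]_(m, n)) : Prop :=
  forall i j, is_L2_scalar Om (fun x => F x i j).

Definition dotL2 {m n : nat} Om (F G : 'rV[R]_d -> 'M[R]_(m, n)) : R :=
  \int[lebesgue_rV R d]_(x in Om) (\sum_i \sum_j F x i j * G x i j).

Definition normL2 {m n : nat} Om (F : 'rV[R]_d -> 'M[R]_(m, n)) : R :=
  Num.sqrt (dotL2 Om F F).

(* L^2_0(Om) *)
Definition is_L20 Om (q : 'rV[R]_d -> R) : Prop :=
  is_L2_scalar Om q /\ \int[lebesgue_rV R d]_(x in Om) q x = 0.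

End lebesgue_space.

Section norms.
Context {R : realType}.

(* Euclidean (Frobenius) norm; the library's norm on matrices is the max norm,
   which only induces the same topology. *)
Definition enorm {m n : nat} (A : 'M[R]_(m, n)) : R :=
  Num.sqrt (\sum_i \sum_j A i j ^+ 2).

Definition spectral_norm {n : nat} (A : 'M[R]_n) : R :=
  sup [set enorm (A *m x) | x in [set x : 'cV[R]_n | enorm x <= 1]].

End norms.

Section sobolev.
Context {R : realType} {d : nat}.
Implicit Type Om : set 'rV[R]_d.

Definition bounded_domain Om : Prop :=
  [/\ open Om, connected Om, Om !=set0 & bounded_set Om].

Definition partial (i : 'I_d) (f : 'rV[R]_d -> R) : 'rV[R]_d -> R :=
  fun x => 'D_(delta_mx 0 i) f x.

(* All iterated partial derivatives exist and are differentiable. *)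
Definition smooth (f : 'rV[R]_d -> R) : Prop :=
  forall (s : seq 'I_d) x, differentiable (foldr partial f s) x.

(* C_c^oo(Om; R^d) *)
Definition test_field Om (phi : 'rV[R]_d -> 'rV[R]_d) : Prop :=
  (forall i, smooth (fun x => phi x 0 i)) /\
  exists K : set 'rV[R]_d,
    [/\ compact K, K `<=` Om & forall x, ~ K x -> phi x = 0].

(* (grad phi)_ij is the j-th partial derivative of the i-th component. *)
Definition grad (phi : 'rV[R]_d -> 'rV[R]_d) : 'rV[R]_d -> 'M[R]_d :=
  fun x => \matrix_(i, j) partial j (fun y => phi y 0 i) x.

End sobolev.

(* A velocity field together with its (weak) gradient. *)
Notation h1pair R d :=
  (('rV[R]_d -> 'rV[R]_d) * ('rV[R]_d -> 'M[R]_d))%type.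

Section sobolev0.
Context {R : realType} {d : nat}.
Implicit Type Om : set 'rV[R]_d.

(* H^1_0(Om; R^d): the closure of C_c^oo(Om; R^d) in the H^1 norm, with v.1 a
   representative of the function and v.2 of its gradient.  The second component
   is the weak gradient of the first, hence determined by it almost everywhere. *)
Definition H10 Om : set (h1pair R d) :=
  [set v | [/\ is_L2 Om v.1, is_L2 Om v.2 &
    forall e : R, 0 < e -> exists phi,
      [/\ test_field Om phi, normL2 Om (v.1 - phi) < e
        & normL2 Om (v.2 - grad phi) < e]]].

Definition div (v : h1pair R d) : 'rV[R]_d -> R := fun x => \tr (v.2 x).

(* (u . grad) v *)
Definition convect (u v : h1pair R d) : 'rV[R]_d -> 'rV[R]_d :=
  fun x => u.1 x *m (v.2 x)^T.

(* L is the weak divergence of grad v. *)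
Definition is_laplacian Om (v : h1pair R d) (L : 'rV[R]_d -> 'rV[R]_d) : Prop :=
  is_L2 Om L /\
  forall phi, test_field Om phi -> dotL2 Om L phi = - dotL2 Om v.2 (grad phi).

(* The time derivative of u at t, taken weakly: (ut, v) = d/dt (u, v) for all v
   in H^1_0; it is one-sided at t = T. *)
Definition is_time_derivative Om (T : R) (u : R -> h1pair R d) (t : R)
    (ut : 'rV[R]_d -> 'rV[R]_d) : Prop :=
  is_L2 Om ut /\
  forall v, H10 Om v ->
    (s - t)^-1 * (dotL2 Om (u s).1 v.1 - dotL2 Om (u t).1 v.1)
      @[s --> within [set s | 0 <= s <= T] t^'] --> dotL2 Om ut v.1.

Definition weak_NSE_solution Om (T nu : R) (f : R -> 'rV[R]_d -> 'rV[R]_d)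
    (u : R -> h1pair R d) (p : R -> 'rV[R]_d -> R) : Prop :=
  (forall t, 0 <= t <= T -> H10 Om (u t)) /\
  (forall t, 0 < t <= T -> is_L20 Om (p t)) /\
  exists ut : R -> 'rV[R]_d -> 'rV[R]_d,
  forall t, 0 < t <= T ->
    [/\ is_time_derivative Om T u t (ut t),
        forall v, H10 Om v ->
          dotL2 Om (ut t) v.1 + nu * dotL2 Om (u t).2 v.2
          + dotL2 Om (convect (u t) (u t)) v.1
          - \int[lebesgue_rV R d]_(x in Om) (div v x * p t x)
          = dotL2 Om (f t) v.1
      & forall q, is_L20 Om q ->
          \int[lebesgue_rV R d]_(x in Om) (div (u t) x * q x) = 0].

End sobolev0.

Section finite_elements.
Context {R : realType} {d : nat}.
Implicit Type Om : set 'rV[R]_d.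

(* The rows of S are the vertices of a d-simplex. *)
Definition face (S : 'M[R]_(d.+1, d)) (A : pred 'I_d.+1) : set 'rV[R]_d :=
  [set x | exists c : 'rV[R]_d.+1,
    [/\ forall i, 0 <= c 0 i, forall i, ~~ A i -> c 0 i = 0,
        \sum_i c 0 i = 1 & x = c *m S]].

Definition simplex (S : 'M[R]_(d.+1, d)) : set 'rV[R]_d := face S predT.

Definition nondegenerate (S : 'M[R]_(d.+1, d)) : Prop :=
  \det (\matrix_(i < d) (row (lift ord0 i) S - row ord0 S)) != 0.

Definition diam (A : set 'rV[R]_d) : R :=
  sup [set enorm (x - y) | x in A & y in A].

(* A conforming triangulation of Om with mesh size h. *)
Definition triangulation Om (Th : seq 'M[R]_(d.+1, d)) (h : R) : Prop :=
  [/\ forall S, S \in Th -> nondegenerate S,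
      \bigcup_(S in [set` Th]) simplex S = closure Om,
      forall S S', S \in Th -> S' \in Th ->
        simplex S `&` simplex S' =
        face S (fun i => [exists j, row i S == row j S'])
    & h = \big[Num.max/0]_(S <- Th) diam (simplex S)].

(* q is continuous on Om and is on every element a polynomial of total degree
   at most k. *)
Definition piecewise_poly Om (Th : seq 'M[R]_(d.+1, d)) (k : nat)
    (q : 'rV[R]_d -> R) : Prop :=
  {within Om, continuous q} /\
  forall S, S \in Th -> exists P : mpoly.mpoly d R,
    (forall a, mpoly.mcoeff a P != 0 -> (mpoly.mdeg a <= k)%N) /\
    forall x, (Om `&` simplex S) x -> q x = mpoly.meval (x 0) P.

Definition taylor_hood Om (Th : seq 'M[R]_(d.+1, d)) (m : nat)
    (Xh : set (h1pair R d)) (Qh : set ('rV[R]_d -> R)) : Prop :=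
  Xh = [set v | H10 Om v /\
         forall i, piecewise_poly Om Th m.+1 (fun x => v.1 x 0 i)] /\
  Qh = [set q | is_L20 Om q /\ piecewise_poly Om Th m q].

End finite_elements.

Section reduced_order_model.
Context {R : realType} {d : nat}.
Implicit Types (Om : set 'rV[R]_d) (phi : nat -> h1pair R d).
Implicit Types Xr : set (h1pair R d).

Definition correlation_mx Om (K : nat) (uh : nat -> h1pair R d) : 'M[R]_K.+1 :=
  \matrix_(k, l) (K.+1%:R^-1 * dotL2 Om (uh k).1 (uh l).1).

(* lam j and phi j, for j < Rk, are the eigenvalue and mode of index j + 1; the
   positive eigenvalues are listed with multiplicity. *)
Definition pod_basis Om (Xh : set (h1pair R d)) (K : nat)
    (uh : nat -> h1pair R d) (Rk : nat) (lam : nat -> R) phi : Prop :=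
  [/\ \rank (correlation_mx Om K uh) = Rk,
      [/\ forall j, (j < Rk)%N -> 0 < lam j,
          forall i j, (i <= j < Rk)%N -> lam j <= lam i
        & char_poly (correlation_mx Om K uh) =
          'X^(K.+1 - Rk) * \prod_(j < Rk) ('X - (lam j)%:P)],
      forall j, (j < Rk)%N -> Xh (phi j),
      forall i j, (i < Rk)%N -> (j < Rk)%N ->
        dotL2 Om (phi i).1 (phi j).1 = (i == j)%:R
    & forall j, (j < Rk)%N ->
        {ae lebesgue_rV R d, forall x, Om x ->
          K.+1%:R^-1 *:
            \sum_(k < K.+1) dotL2 Om (phi j).1 (uh k).1 *: (uh k).1 x
          = lam j *: (phi j).1 x}].

(* span {phi_1, ..., phi_r} *)
Definition pod_space phi (r : nat) : set (h1pair R d) :=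
  [set v | exists c : 'I_r -> R, v = \sum_(j < r) c j *: phi j].

Definition stiffness_mx Om phi (r : nat) : 'M[R]_r :=
  \matrix_(i, j) dotL2 Om (phi i).2 (phi j).2.

(* The element of Xr with the defining property; the default value 0 of xget is
   never used for w in L^2, where this element exists and is unique. *)
Definition rom_proj Om Xr (w : 'rV[R]_d -> 'rV[R]_d) : h1pair R d :=
  xget 0 [set P | Xr P /\
    forall v, Xr v -> dotL2 Om P.1 v.1 = dotL2 Om w v.1].

Definition rom_filter Om Xr (delta : R) (w : 'rV[R]_d -> 'rV[R]_d) :
    h1pair R d :=
  xget 0 [set F | Xr F /\
    forall v, Xr v ->
      delta ^+ 2 * dotL2 Om F.2 v.2 + dotL2 Om F.1 v.1 = dotL2 Om w v.1].

Definition van_cittert Om Xr (delta : R) (N : nat) (w : h1pair R d) :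
    h1pair R d :=
  \sum_(n < N.+1) iter n (fun v => v - rom_filter Om Xr delta v.1) w.

End reduced_order_model.

(* Main.v *)
(* Let w = P^r u and G = I - F^r on X^r.  The filter sees u only through w, and the
   van Cittert sum telescopes, so D_N^r (F^r u) = w - G^(N+1) w and
   u - D_N^r (F^r u) = (u - w) + G^(N+1) w.  As G is an L2 contraction, only
   e = G w has to be estimated.  It satisfies
   delta^2 (grad e, grad v) + (e, v) = delta^2 (grad w, grad v) for v in X^r;
   writing w = u - (u - w), integrating grad u by parts and testing with v = e
   gives |e|^2 <= delta^2 |grad (u - w)|^2 + delta^4 |Delta u|^2 by Young's
   inequality.  Hence C(N) = 2|C| + 2 works for every N. *)
Require Import Defs.
From HB Require Import structures.
From mathcomp Require Import all_boot all_order all_algebra.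
From mathcomp Require Import all_classical all_reals all_analysis.
From mathcomp Require Import measurable_realfun lra.
Set Implicit Arguments.
Unset Strict Implicit.
Unset Printing Implicit Defensive.
Import Order.TTheory GRing.Theory Num.Theory.
Import numFieldNormedType.Exports.
Local Open Scope classical_set_scope.
Local Open Scope ring_scope.

(** * Borel measurability and compact sets for Lebesgue measure on row vectors *)

Section continuous_measurable.
Context {R : realType} {n : nat}.

Lemma ball_rVE (x y : 'rV[R]_n) (e : R) : 0 < e ->
  ball x e y <-> forall i, `|x 0 i - y 0 i| < e.
Proof.
move=> e0; split=> [[_ xy] i|xy]; first exact: xy.
by split=> // i j; rewrite ord1; exact: xy.
Qed.

Lemma measurable_ball_rV (x : 'rV[R]_n) (e : R) : 0 < e ->
  measurable (ball x e).
Proof.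
move=> e0; rewrite (_ : ball x e = \bigcap_(i in [set: 'I_n])
    ((fun y : 'rV[R]_n => y 0 i) @^-1` ball (x 0 i) e)).
  apply: fin_bigcap_measurable => // i _.
  rewrite -[X in measurable X]setTI; apply: measurable_coord => //.
  exact: measurable_ball.
apply/seteqP; split=> y.
  by move/(ball_rVE _ _ e0) => xy i _; exact: xy.
by move=> xy; apply/(ball_rVE _ _ e0) => i; exact: xy.
Qed.

(** The balls with rational centre and radius [1/(k+1)] lying inside [A] are countably many and
    cover it; each is a finite intersection of coordinate preimages. *)
Lemma open_measurable_rV (A : set 'rV[R]_n) : open A -> measurable A.
Proof.
move=> oA.
pose B (p : 'rV[rat]_n * nat) : set 'rV[R]_n :=
  ball (map_mx ratr p.1 : 'rV[R]_n) p.2.+1%:R^-1.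
rewrite (_ : A = \bigcup_p (if `[< B p `<=` A >] then B p else set0)).
  apply: countable_bigcupT_measurable; first exact: countableP.
  by move=> p; case: ifP => // _; apply: measurable_ball_rV; rewrite invr_gt0.
apply/seteqP; split=> [x Ax|x [p _]]; last by case: asboolP => // /[apply].
have /nbhs_ballP[e /= e0 xeA] := open_nbhs_nbhs (conj oA Ax).
(* Half of [e], since a ball of radius [1/(k+1)] containing [x] stays within twice that radius of
   [x]. *)
have [k ke] : exists k, k.+1%:R^-1 < e / 2.
  have e20 : 0 < e / 2 by exact: divr_gt0.
  have [k _ /(_ k)] := near_infty_natSinv_lt (PosNum e20).
  by move=> /(_ (leqnn _)); exists k.
have k0 : 0 < k.+1%:R^-1 :> R by rewrite invr_gt0.
have /choice[q xq] : forall i : 'I_n, exists q : rat,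
    `|ratr q - x 0 i| < k.+1%:R^-1.
  move=> i; have [|q] := @rat_in_itvoo R (x 0 i - k.+1%:R^-1) (x 0 i + k.+1%:R^-1).
    by rewrite ltrD2l gtrN.
  by rewrite in_itv /= => qx; exists q; rewrite ltr_distl.
have Bx : B (\row_i q i, k) x.
  by apply/ball_rVE => // i; rewrite !mxE; exact: xq.
exists (\row_i q i, k) => //; case: asboolP => // -[] y By; apply: xeA.
apply: le_ball (ltW _ : k.+1%:R^-1 + k.+1%:R^-1 <= e) _ _.
  by rewrite [ltRHS]splitr ltrD.
by apply: ball_triangle (ball_sym Bx) By.
Qed.

Lemma continuous_measurable_rV (f : 'rV[R]_n -> R) :
  continuous f -> measurable_fun setT f.
Proof.
move=> /continuousP cf; apply: (measurability _ (RGenOpens.measurableE R)).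
move=> _ [_ [a [b ->] <-]]; rewrite setTI.
by apply: open_measurable_rV; exact: cf.
Qed.

Lemma measurable_box (a b : 'rV[R]_n) :
  measurable [set x : 'rV[R]_n | forall i, a 0 i <= x 0 i <= b 0 i].
Proof.
rewrite (_ : [set x | _] = \bigcap_(i in [set: 'I_n])
    ((fun y : 'rV[R]_n => y 0 i) @^-1` `[a 0 i, b 0 i]%classic)).
  apply: fin_bigcap_measurable => // i _.
  by rewrite -[X in measurable X]setTI; exact: measurable_coord.
apply/seteqP; split=> y /= yab i; first by move=> _; rewrite /= in_itv; exact: yab.
by have := yab i I; rewrite /= in_itv.
Qed.

Lemma compact_measurable_rV (K : set 'rV[R]_n) : compact K -> measurable K.
Proof.
move=> cK; have clK : closed K by apply: compact_closed => //; exact: norm_hausdorff.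
rewrite -[K]setCK; apply: measurableC; apply: open_measurable_rV.
exact: closed_openC.
Qed.

Lemma lebesgue_rV_compact (K : set 'rV[R]_n) :
  compact K -> (lebesgue_rV R n K < +oo)%E.
Proof.
move=> cK; have /compact_bounded[M [_ KM]] := cK.
(* [compact_bounded] bounds [K] by every number above [M], and [|M| + 1] is one; as the norm is the
   max norm, it serves as half-side of a box around [K]. *)
pose b : 'rV[R]_n := const_mx (`|M| + 1).
have Kb : K `<=` [set x : 'rV[R]_n | forall i, (- b) 0 i <= x 0 i <= b 0 i].
  move=> x Kx i; rewrite !mxE -ler_norml.
  have xM : `|x| <= `|M| + 1.
    by apply: KM Kx; rewrite (le_lt_trans (ler_norm _))// ltrDl.
  apply: le_trans xM; rewrite [leRHS](mx_normrE x).
  by apply: (le_bigmax _ (fun ij : 'I_1 * 'I_n => `|x ij.1 ij.2|) (0, i)).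
apply: le_lt_trans (le_measure _ _ _ Kb) _.
- by rewrite inE; exact: compact_measurable_rV.
- by rewrite inE; exact: measurable_box.
rewrite [ltLHS](_ : _ = (\prod_i (b 0 i - (- b) 0 i))%:E) ?ltry//.
apply: lebesgue_rV_box => i.
by rewrite !mxE -subr_ge0 opprK addr_ge0// addr_ge0.
Qed.

End continuous_measurable.

(** * Square integrability of test fields and of their gradients *)

Section test_fields.
Context {R : realType} {d : nat}.
Implicit Types (Om K : set 'rV[R]_d) (f : 'rV[R]_d -> R).

(** The square of [f] is at most [M ^+ 2] times the indicator of [K], and [K] has finite measure. *)
Lemma is_L2_scalar_compact_support Om K f : measurable Om -> compact K ->
  continuous f -> (forall x, ~ K x -> f x = 0) -> is_L2_scalar Om f.
Proof.
move=> mOm cK cf f0.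
have mf : measurable_fun setT f by exact: continuous_measurable_rV.
have mfO : measurable_fun setT (f \_ Om).
  apply/(measurable_restrictT _ mOm); exact: measurable_funTS mf.
have mK : measurable K by exact: compact_measurable_rV.
have [M M0 fM] : exists2 M : R, 0 <= M & forall x, `|f x| <= M.
  have [|N [_ fN]] := @compact_bounded _ _ (f @` K).
    by apply: continuous_compact => //; exact: continuous_subspaceT.
  exists (`|N| + 1); first by rewrite addr_ge0.
  move=> x; have [Kx|/f0 ->] := pselect (K x); last by rewrite normr0 addr_ge0.
  by apply: fN; [rewrite (le_lt_trans (ler_norm _))// ltrDl|exists x].
rewrite /is_L2_scalar inE; apply/andP; split; first by rewrite inE.
rewrite inE /= /finite_norm unlock poweR_lty//.
apply: (@le_lt_trans _ _ (\int[lebesgue_rV R d]_(x in K) cst (M ^+ 2)%:E x)%E).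
  rewrite [leRHS]integral_mkcond; apply: ge0_le_integral => //.
  - by move=> x _; exact: poweR_ge0.
  - apply/measurable_EFinP.
    apply: (@measurableT_comp _ _ _ _ _ _ (fun y : R => y `^ 2)) => //.
    exact: measurableT_comp.
  - by apply/(measurable_restrictT _ mK); exact: measurable_cst.
  - move=> x _ /=; rewrite !patchE.
    have fx0 : x \notin K -> f x = 0 by move=> /negP; rewrite inE => /f0.
    case: (boolP (x \in Om)) => _; last first.
      by rewrite normr0 powR0//; case: ifP; rewrite lee_fin ?sqr_ge0.
    case: (boolP (x \in K)) => [_|/fx0 ->]; last by rewrite normr0 powR0.
    by rewrite lee_fin powR_mulrn// ler_pXn2r// nnegrE.
rewrite integral_cst// lte_mul_pinfty ?lee_fin ?exprn_ge0//.
exact: lebesgue_rV_compact.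
Qed.

Lemma continuous_partial (i : 'I_d) f : smooth f -> continuous (partial i f).
Proof. by move=> sf x; apply: differentiable_continuous; exact: (sf [:: i]). Qed.

Lemma partial_compact_support (i : 'I_d) K f : compact K ->
  (forall x, ~ K x -> f x = 0) -> forall x, ~ K x -> partial i f x = 0.
Proof.
move=> cK f0 x nKx.
have clK : closed K by apply: compact_closed => //; exact: norm_hausdorff.
rewrite /partial (@near_eq_derive _ _ _ f (cst 0)) ?derive_cst//.
have : nbhs x (~` K) by apply: open_nbhs_nbhs; split => //; exact: closed_openC.
by apply: filterS => y; exact: f0.
Qed.

Variable (Om : set 'rV[R]_d).
Hypothesis mOm : measurable Om.

Lemma test_field_is_L2 (phi : 'rV[R]_d -> 'rV[R]_d) :
  test_field Om phi -> is_L2 Om phi.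
Proof.
move=> [sphi [K [cK _ phi0]]] i j; rewrite ord1.
apply: (is_L2_scalar_compact_support mOm cK) => [x|x /phi0 ->].
  by apply: differentiable_continuous; exact: (sphi j [::]).
by rewrite mxE.
Qed.

Lemma grad_test_field_is_L2 (phi : 'rV[R]_d -> 'rV[R]_d) :
  test_field Om phi -> is_L2 Om (grad phi).
Proof.
move=> [sphi [K [cK _ phi0]]] i j.
rewrite (_ : (fun x => grad phi x i j) = partial j (fun y => phi y 0 i)).
  apply: (is_L2_scalar_compact_support mOm cK); first exact: continuous_partial.
  by apply: partial_compact_support => // x /phi0 ->; rewrite mxE.
by apply/funext => x; rewrite mxE.
Qed.

End test_fields.

(** * The L2 inner product *)

Section L2_inner_product.
Context {R : realType} {d m n : nat} (Om : set 'rV[R]_d).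
Hypothesis mOm : measurable Om.
Implicit Types F G H : 'rV[R]_d -> 'M[R]_(m, n).

Lemma is_L2_comb (a : R) F G :
  is_L2 Om F -> is_L2 Om G -> is_L2 Om (a *: F + G).
Proof.
move=> LF LG i j; rewrite /is_L2_scalar.
rewrite (_ : _ \_ _ = a *: ((fun x => F x i j) \_ Om) + ((fun x => G x i j) \_ Om)).
  have [_] := Lfun_submod_closed (lebesgue_rV R d) (lee1n 2).
  by apply; [exact: LF|exact: LG].
apply/funext => x; rewrite !fctE /= !patchE.
by case: ifP => _; rewrite ?mxE // scaler0 addr0.
Qed.

Lemma is_L2_0 : is_L2 Om (0 : 'rV[R]_d -> 'M[R]_(m, n)).
Proof.
move=> i j; rewrite /is_L2_scalar (_ : _ \_ _ = 0).
  by have [] := Lfun_submod_closed (lebesgue_rV R d) (lee1n 2).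
by apply/funext => x; rewrite patchE mxE; case: ifP.
Qed.

(** Hölder with exponents 2 and 2, entry by entry. Additivity of the integral asks for
    integrability, so the bilinearity rules rest on this. *)
Lemma integrable_dotL2 F G : is_L2 Om F -> is_L2 Om G ->
  (lebesgue_rV R d).-integrable Om
    (EFin \o (fun x => \sum_i \sum_j F x i j * G x i j)).
Proof.
move=> LF LG.
rewrite (_ : _ \o _ = fun x => (\sum_i \sum_j (F x i j * G x i j)%:E)%E).
  apply: integrable_sum => // i _; apply: integrable_sum => // j _.
  apply/(integrable_mkcond _ mOm).
  rewrite (_ : _ \_ _ =
    EFin \o (((fun x => F x i j) \_ Om) \* ((fun x => G x i j) \_ Om))).
    by apply/Lfun1_integrable/Lfun2_mul_Lfun1; [exact: LF|exact: LG].
  by apply/funext => x; rewrite /= !patchE; case: ifP => // _; rewrite mulr0.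
by apply/funext => x /=; rewrite -sumEFin; apply: eq_bigr => i _; rewrite sumEFin.
Qed.

Lemma dotL2C F G : dotL2 Om F G = dotL2 Om G F.
Proof.
apply: eq_Rintegral => x _; apply: eq_bigr => i _; apply: eq_bigr => j _.
exact: mulrC.
Qed.

Lemma dotL2_combl (a : R) F G H : is_L2 Om F -> is_L2 Om G -> is_L2 Om H ->
  dotL2 Om (a *: F + G) H = a * dotL2 Om F H + dotL2 Om G H.
Proof.
move=> LF LG LH; have iFH := integrable_dotL2 LF LH.
have iGH := integrable_dotL2 LG LH.
rewrite /dotL2 -RintegralZl// -RintegralD//; last exact: (integrableZl mOm a iFH).
apply: eq_Rintegral => x _; rewrite mulr_sumr -big_split /=.
apply: eq_bigr => i _; rewrite mulr_sumr -big_split /=.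
by apply: eq_bigr => j _; rewrite !mxE mulrDl mulrA.
Qed.

Lemma dotL2_ge0 F : 0 <= dotL2 Om F F.
Proof.
apply: Rintegral_ge0 => x _; apply: sumr_ge0 => i _; apply: sumr_ge0 => j _.
exact: sqr_ge0.
Qed.

End L2_inner_product.

Section L2_inner_product_theory.
Context {R : realType} {d m n : nat} (Om : set 'rV[R]_d).
Hypothesis mOm : measurable Om.
Implicit Types F G H : 'rV[R]_d -> 'M[R]_(m, n).

Lemma sqr_normL2 F : normL2 Om F ^+ 2 = dotL2 Om F F.
Proof. by rewrite sqr_sqrtr// dotL2_ge0. Qed.

Lemma dotL2_combr (a : R) F G H : is_L2 Om F -> is_L2 Om G -> is_L2 Om H ->
  dotL2 Om H (a *: F + G) = a * dotL2 Om H F + dotL2 Om H G.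
Proof. by move=> *; rewrite dotL2C dotL2_combl// !(dotL2C _ H). Qed.

Lemma is_L2D F G : is_L2 Om F -> is_L2 Om G -> is_L2 Om (F + G).
Proof. by rewrite -[F in F + G]scale1r; exact: is_L2_comb. Qed.

Lemma is_L2B F G : is_L2 Om F -> is_L2 Om G -> is_L2 Om (F - G).
Proof. by rewrite -scaleN1r addrC => LF LG; exact: is_L2_comb. Qed.

Lemma dotL2Dl F G H : is_L2 Om F -> is_L2 Om G -> is_L2 Om H ->
  dotL2 Om (F + G) H = dotL2 Om F H + dotL2 Om G H.
Proof. by move=> *; rewrite -[F in F + G]scale1r dotL2_combl// mul1r. Qed.

Lemma dotL2Bl F G H : is_L2 Om F -> is_L2 Om G -> is_L2 Om H ->
  dotL2 Om (F - G) H = dotL2 Om F H - dotL2 Om G H.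
Proof.
by move=> *; rewrite -scaleN1r addrC dotL2_combl// mulN1r addrC.
Qed.

Lemma dotL2Br F G H : is_L2 Om F -> is_L2 Om G -> is_L2 Om H ->
  dotL2 Om H (F - G) = dotL2 Om H F - dotL2 Om H G.
Proof. by move=> *; rewrite dotL2C dotL2Bl// !(dotL2C _ H). Qed.

Lemma dotL2_0l H : is_L2 Om H -> dotL2 Om 0 H = 0.
Proof. by move=> LH; rewrite -[X in dotL2 _ X](subrr H) dotL2Bl// subrr. Qed.

(** Expansion of [|G - t F|^2 >= 0]. The free sign and size of [t] let it stand in for
    Cauchy-Schwarz. *)
Lemma dotL2_young (t : R) F G : is_L2 Om F -> is_L2 Om G ->
  2 * t * dotL2 Om F G <= t ^+ 2 * dotL2 Om F F + dotL2 Om G G.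
Proof.
move=> LF LG; have := dotL2_ge0 Om (- t *: F + G).
have LH : is_L2 Om (- t *: F + G) by exact: is_L2_comb.
rewrite dotL2_combl// !dotL2_combr// (dotL2C _ G F); lra.
Qed.

Lemma dotL2D_le F G : is_L2 Om F -> is_L2 Om G ->
  dotL2 Om (F + G) (F + G) <= 2 * dotL2 Om F F + 2 * dotL2 Om G G.
Proof.
move=> LF LG; have LFG := is_L2D LF LG.
rewrite (dotL2Dl LF LG LFG) !(dotL2C _ _ (F + G)) !dotL2Dl// (dotL2C _ G F).
have := dotL2_young 1 LF LG.
move: (dotL2 Om F F) (dotL2 Om F G) (dotL2 Om G G) => a b c; lra.
Qed.

Lemma is_L2_sum (I : Type) (s : seq I) (c : I -> R)
    (F : I -> 'rV[R]_d -> 'M[R]_(m, n)) :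
  (forall i, is_L2 Om (F i)) -> is_L2 Om (\sum_(i <- s) c i *: F i).
Proof.
move=> LF; elim/big_rec: _ => [|i G _ LG]; first exact: is_L2_0.
exact: is_L2_comb.
Qed.

Lemma dotL2_suml (I : Type) (s : seq I) (c : I -> R)
    (F : I -> 'rV[R]_d -> 'M[R]_(m, n)) H :
  (forall i, is_L2 Om (F i)) -> is_L2 Om H ->
  dotL2 Om (\sum_(i <- s) c i *: F i) H = \sum_(i <- s) c i * dotL2 Om (F i) H.
Proof.
move=> LF LH; elim: s => [|i s IHs]; first by rewrite !big_nil dotL2_0l.
by rewrite !big_cons dotL2_combl ?IHs//; exact: is_L2_sum.
Qed.

End L2_inner_product_theory.

(** * Integration by parts against H^1_0 fields *)

Section weak_laplacian.
Context {R : realType} {d : nat} (Om : set 'rV[R]_d).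
Hypothesis mOm : measurable Om.

(** For test fields this is the definition of the weak Laplacian; it extends by density, the defect
    [x] being forced to 0 by a bound quadratic in a free parameter. *)
Lemma dotL2_laplacian (u v : h1pair R d) (L : 'rV[R]_d -> 'rV[R]_d) :
  is_L2 Om u.2 -> is_laplacian Om u L -> H10 Om v ->
  dotL2 Om L v.1 = - dotL2 Om u.2 v.2.
Proof.
move=> Lu [LL Lphi] [Lv1 Lv2 Hv].
set A := dotL2 Om L L; set B := dotL2 Om u.2 u.2.
apply/eqP; rewrite -subr_eq0 opprK; set x := _ + _.
(* Subtracting a test field [phi] from [v] does not change the defect; with [phi] within [e] of [v],
   each of two Young bounds leaves one [e ^+ 2]. *)
have xe (t e : R) : 0 < e -> 2 * t * x <= t ^+ 2 * (A + B) + 2 * e ^+ 2.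
  move=> e0; have [phi [tphi phi1 phi2]] := Hv e e0.
  have L1 := test_field_is_L2 mOm tphi; have L2 := grad_test_field_is_L2 mOm tphi.
  have -> : x = dotL2 Om L (v.1 - phi) + dotL2 Om u.2 (v.2 - grad phi).
    by rewrite !dotL2Br// (Lphi phi)// opprK addrACA subrr addr0.
  have LF := is_L2B Lv1 L1; have LG := is_L2B Lv2 L2.
  have := dotL2_young mOm t LL LF; have := dotL2_young mOm t Lu LG.
  have sqe (y : R) : 0 <= y -> y < e -> y ^+ 2 <= e ^+ 2.
    by move=> y0 ye; rewrite ler_pXn2r ?nnegrE//; exact: ltW.
  have := sqe _ (sqrtr_ge0 _) phi1; have := sqe _ (sqrtr_ge0 _) phi2.
  rewrite !sqr_normL2 -/A -/B.
  move: (dotL2 _ _ _) (dotL2 _ _ _) (dotL2 _ L _) (dotL2 _ u.2 _) => a b c g.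
  lra.
have xt (t : R) : 2 * t * x <= t ^+ 2 * (A + B).
  apply/ler_addgt0Pr => e e0.
  have := xe t (Num.sqrt (e / 2)); rewrite sqrtr_gt0 sqr_sqrtr; last lra.
  by move=> /(_ ltac:(lra)); lra.
have AB0 : 0 <= A + B by rewrite addr_ge0// dotL2_ge0.
(* This choice of [t] turns the bound into [y ^+ 2 * (A + B + 2) <= 0]; the added 1 keeps the
   denominator positive. *)
have := xt (x / (A + B + 1)); set y := x / _.
have -> : x = y * (A + B + 1) by rewrite divfK//; lra.
move=> yAB; have y2 : y ^+ 2 * (A + B + 2) <= 0 by lra.
suff : y ^+ 2 == 0 by rewrite sqrf_eq0 => /eqP ->; rewrite mul0r.
by rewrite eq_le sqr_ge0 andbT -(pmulr_lle0 (x := A + B + 2))//; lra.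
Qed.

End weak_laplacian.

(** * Splitting of the error and absorption in the energy estimate *)

Lemma h1_fstB (R : realType) (d : nat) (v w : h1pair R d) : (v - w).1 = v.1 - w.1.
Proof. by []. Qed.

Lemma h1_sndB (R : realType) (d : nat) (v w : h1pair R d) : (v - w).2 = v.2 - w.2.
Proof. by []. Qed.

Lemma sqr_normL2_error_split (R : realType) (d : nat) (Om : set 'rV[R]_d)
    (u w z : h1pair R d) : measurable Om ->
  is_L2 Om u.1 -> is_L2 Om w.1 -> is_L2 Om z.1 ->
  normL2 Om (u - (w - z)).1 ^+ 2 <=
    2 * normL2 Om (u - w).1 ^+ 2 + 2 * normL2 Om z.1 ^+ 2.
Proof.
move=> mOm Lu Lw Lz; rewrite !sqr_normL2 !h1_fstB opprB addrA addrAC.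
by apply: dotL2D_le => //; exact: is_L2B.
Qed.

(* In the application E and Y are the squared norms of the residual e and of its
   gradient, p = (grad u, grad e), b = (grad w, grad e) and q = (L, e). *)
Lemma energy_estimate (R : realFieldType) (t Y E LL q p a b c X : R) : 0 <= Y ->
  q = - p -> c = p - b ->
  2 * - t ^+ 2 * q <= (- t ^+ 2) ^+ 2 * LL + E ->
  2 * -1 * c <= (-1) ^+ 2 * X + Y ->
  t ^+ 2 * (b - Y) + (a - E) = a ->
  E <= t ^+ 2 * X + t ^+ 4 * LL.
Proof.
(* Twice the tested equation reads [2E = -2t^2 q - 2t^2 c - 2t^2 Y]. The Young bounds put
   [E + t^2 Y] on the right, which is absorbed and leaves a spare [-t^2 Y <= 0]. *)
move=> Y0 -> -> qE cX Eeq; rewrite -[t ^+ 4]/(t ^+ (2 * 2)) exprM.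
have := ler_wpM2l (sqr_ge0 t) cX; have := mulr_ge0 (sqr_ge0 t) Y0.
by move: (t ^+ 2) qE Eeq => s; lra.
Qed.

(** * Filter and projection on the POD space *)

Section reduced_order_model.
Context {R : realType} {d : nat} (Om : set 'rV[R]_d).
Hypothesis mOm : measurable Om.
Variables (r : nat) (phi : nat -> h1pair R d).
Hypothesis phi_L2 : forall i, (i < r)%N -> is_L2 Om (phi i).1 /\ is_L2 Om (phi i).2.
Hypothesis phi_orthonormal : forall i j, (i < r)%N -> (j < r)%N ->
  dotL2 Om (phi i).1 (phi j).1 = (i == j)%:R.
Local Notation Xr := (pod_space phi r).
Implicit Types (v w : h1pair R d) (delta : R) (c : 'I_r -> R).

(* At delta = 0 this is the L2 product, which makes the projection the filter of
   radius 0. *)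
Let form delta v w := delta ^+ 2 * dotL2 Om v.2 w.2 + dotL2 Om v.1 w.1.

Let comb c : h1pair R d := \sum_(j < r) c j *: phi j.

Lemma comb_fst c : (comb c).1 = \sum_(j < r) c j *: (phi j).1.
Proof. exact: (big_morph fst (id1 := 0) (op1 := +%R)). Qed.

Lemma comb_snd c : (comb c).2 = \sum_(j < r) c j *: (phi j).2.
Proof. exact: (big_morph snd (id1 := 0) (op1 := +%R)). Qed.

Lemma pod_space_L2 v : Xr v -> is_L2 Om v.1 /\ is_L2 Om v.2.
Proof.
move=> [c ->]; rewrite comb_fst comb_snd.
by split; apply: is_L2_sum => // i; have [] := phi_L2 (ltn_ord i).
Qed.

Lemma pod_spaceB v w : Xr v -> Xr w -> Xr (v - w).
Proof.
move=> [b ->] [c ->]; exists (fun j => b j - c j).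
by rewrite -sumrB; apply: eq_bigr => j _; rewrite scalerBl.
Qed.

Lemma form_combl delta c w : is_L2 Om w.1 -> is_L2 Om w.2 ->
  form delta (comb c) w = \sum_(j < r) c j * form delta (phi j) w.
Proof.
move=> L1 L2; rewrite /form comb_fst comb_snd.
rewrite !dotL2_suml//; try by move=> i; have [] := phi_L2 (ltn_ord i).
rewrite mulr_sumr -big_split; apply: eq_bigr => j _ /=.
by rewrite mulrDr mulrCA.
Qed.

Lemma formC delta v w : form delta v w = form delta w v.
Proof. by rewrite /form (dotL2C _ v.2) (dotL2C _ v.1). Qed.

Lemma dotL2_comb c : dotL2 Om (comb c).1 (comb c).1 = \sum_(j < r) c j ^+ 2.
Proof.
have Lphi (i : 'I_r) : is_L2 Om (phi i).1 by have [] := phi_L2 (ltn_ord i).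
rewrite comb_fst dotL2_suml//; last exact: is_L2_sum.
apply: eq_bigr => i _; rewrite dotL2C dotL2_suml// (bigD1 i)//= phi_orthonormal//.
rewrite eqxx mulr1 big1 ?addr0// => j ji.
by rewrite phi_orthonormal// (negbTE (ji : (j : nat) != i)) mulr0.
Qed.

(** Orthonormality makes the L2 part the sum of the squared coefficients, and the gradient part is
    nonnegative; so radius 0 is covered too. *)
Lemma form_definite delta c : form delta (comb c) (comb c) = 0 -> forall j, c j = 0.
Proof.
rewrite /form dotL2_comb => /eqP.
have c0 : 0 <= \sum_(j < r) c j ^+ 2 by apply: sumr_ge0 => j _; exact: sqr_ge0.
rewrite paddr_eq0//; last by rewrite mulr_ge0 ?dotL2_ge0 ?sqr_ge0.
move=> /andP[_].
rewrite psumr_eq0; last by move=> j _; exact: sqr_ge0.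
by move=> /allP cj j; apply/eqP; rewrite -sqrf_eq0; apply: cj; rewrite mem_index_enum.
Qed.

Lemma pod_space_eq0 delta v : Xr v -> (forall w, Xr w -> form delta v w = 0) -> v = 0.
Proof.
move=> Xv v0; have := v0 _ Xv; case: Xv => c -> /form_definite c0.
by apply: big1 => j _; rewrite c0 scale0r.
Qed.

(** In the POD basis the filter equation is a square linear system whose matrix [M] is the Gram
    matrix of a definite form, hence invertible. *)
Lemma rom_filter_exists delta (w : 'rV[R]_d -> 'rV[R]_d) : is_L2 Om w ->
  exists F, Xr F /\ forall v, Xr v -> form delta F v = dotL2 Om w v.1.
Proof.
move=> Lw; pose M := \matrix_(i < r, j < r) form delta (phi i) (phi j).
have combM (x : 'rV[R]_r) (j : 'I_r) :
    form delta (comb (fun i => x 0 i)) (phi j) = (x *m M) 0 j.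
  have [L1 L2] := phi_L2 (ltn_ord j).
  by rewrite form_combl// mxE; apply: eq_bigr => i _; rewrite mxE.
have unitM : M \in unitmx.
  rewrite -row_free_unit; apply: inj_row_free => x xM0.
  apply/rowP => j; rewrite mxE; move: j; apply: (@form_definite delta).
  have [L1 L2] : is_L2 Om (comb (x 0)).1 /\ is_L2 Om (comb (x 0)).2.
    by apply: pod_space_L2; exists (x 0).
  rewrite form_combl// big1// => j _.
  by rewrite formC combM xM0 mxE mulr0.
pose b : 'rV[R]_r := \row_j dotL2 Om w (phi j).1.
have XF : Xr (comb ((b *m invmx M) 0)) by exists ((b *m invmx M) 0).
exists (comb ((b *m invmx M) 0)); split=> // _ [c ->].
have [L1 L2] := pod_space_L2 XF.
rewrite -/(comb c) formC form_combl// comb_fst dotL2C dotL2_suml//; last first.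
  by move=> i; have [] := phi_L2 (ltn_ord i).
apply: eq_bigr => j _; congr (_ * _).
by rewrite formC combM mulmxKV// mxE dotL2C.
Qed.

Lemma rom_filterP delta (w : 'rV[R]_d -> 'rV[R]_d) : is_L2 Om w ->
  Xr (rom_filter Om Xr delta w) /\
  forall v, Xr v -> form delta (rom_filter Om Xr delta w) v = dotL2 Om w v.1.
Proof. by move=> /(rom_filter_exists delta) /(xgetPex 0). Qed.

Lemma rom_filter_unique delta (w : 'rV[R]_d -> 'rV[R]_d) F : is_L2 Om w ->
  Xr F -> (forall v, Xr v -> form delta F v = dotL2 Om w v.1) ->
  rom_filter Om Xr delta w = F.
Proof.
move=> Lw XF FP; have [XG GP] := rom_filterP delta Lw.
apply/eqP; rewrite -subr_eq0; apply/eqP.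
apply: (@pod_space_eq0 delta); first exact: pod_spaceB.
move=> v Xv; apply/eqP; rewrite -(subrr (dotL2 Om w v.1)) -{1}(GP _ Xv) -(FP _ Xv).
have [? ?] := pod_space_L2 XF; have [? ?] := pod_space_L2 XG.
have [? ?] := pod_space_L2 Xv.
by rewrite /form !dotL2Bl// mulrBr opprD addrACA.
Qed.

Lemma rom_proj_filter0 (w : 'rV[R]_d -> 'rV[R]_d) :
  rom_proj Om Xr w = rom_filter Om Xr 0 w.
Proof.
rewrite /rom_proj /rom_filter; congr (xget 0 _); apply/seteqP.
by split=> P [XP Pw]; split=> // v /Pw; rewrite expr0n mul0r add0r.
Qed.

Lemma rom_projP (w : 'rV[R]_d -> 'rV[R]_d) : is_L2 Om w ->
  Xr (rom_proj Om Xr w) /\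
  forall v, Xr v -> dotL2 Om (rom_proj Om Xr w).1 v.1 = dotL2 Om w v.1.
Proof.
move=> /(rom_filterP 0); rewrite rom_proj_filter0 => -[XP Pw].
by split=> // v /Pw; rewrite /form expr0n mul0r add0r.
Qed.

(** A field and its projection give the same right-hand side on [Xr], so uniqueness applies. *)
Lemma rom_filter_proj delta (w : 'rV[R]_d -> 'rV[R]_d) : is_L2 Om w ->
  rom_filter Om Xr delta (rom_proj Om Xr w).1 = rom_filter Om Xr delta w.
Proof.
move=> Lw; have [XP Pw] := rom_projP Lw; have [LP _] := pod_space_L2 XP.
have [XF FP] := rom_filterP delta Lw.
by apply: rom_filter_unique => // v Xv; rewrite FP// Pw.
Qed.

(** * The residual operator and van Cittert deconvolution *)

Section deconvolution.
Variable delta : R.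

(** The operator [I - F^r] on pairs, convertible with the map that [van_cittert] iterates. *)
Definition rom_residual v : h1pair R d := v - rom_filter Om Xr delta v.1.
Local Notation residual := rom_residual.

Lemma residual_pod v : Xr v -> Xr (residual v).
Proof.
move=> Xv; apply: pod_spaceB => //; apply: (rom_filterP delta _).1.
exact: (pod_space_L2 Xv).1.
Qed.

Lemma iter_residual_pod k v : Xr v -> Xr (iter k residual v).
Proof. by move=> Xv; elim: k => //= k; exact: residual_pod. Qed.

(** The difference of the filtered fields solves the filter equation for [v - w], so uniqueness
    gives additivity. *)
Lemma residualB v w : Xr v -> Xr w -> residual (v - w) = residual v - residual w.
Proof.
move=> Xv Xw; have [Lv _] := pod_space_L2 Xv; have [Lw _] := pod_space_L2 Xw.
have [Xv' Fv] := rom_filterP delta Lv; have [Xw' Fw] := rom_filterP delta Lw.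
rewrite /residual (@rom_filter_unique _ _
  (rom_filter Om Xr delta v.1 - rom_filter Om Xr delta w.1)).
- by rewrite !opprB addrACA [RHS]addrACA; congr (_ + _); exact: addrC.
- exact: is_L2B.
- exact: pod_spaceB.
move=> z Xz; have [Lv1 Lv2] := pod_space_L2 Xv'.
have [Lw1 Lw2] := pod_space_L2 Xw'; have [Lz1 Lz2] := pod_space_L2 Xz.
rewrite (dotL2Bl mOm Lv Lw Lz1) -(Fv _ Xz) -(Fw _ Xz) /form.
by rewrite (dotL2Bl mOm Lv1 Lw1 Lz1) (dotL2Bl mOm Lv2 Lw2 Lz2) mulrBr opprD addrACA.
Qed.

(** With [F = w - G w], additivity gives [G^k F = G^k w - G^(k+1) w]; the [N + 1] terms
    telescope. *)
Lemma van_cittert_filter N w : Xr w ->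
  van_cittert Om Xr delta N (rom_filter Om Xr delta w.1) =
  w - iter N.+1 residual w.
Proof.
move=> Xw; set F := rom_filter _ _ _ _.
have iterF k : iter k residual F = iter k residual w - iter k.+1 residual w.
  elim: k => [|k IHk]; first by rewrite /= /residual opprB addrC subrK.
  rewrite iterS IHk (residualB (iter_residual_pod k Xw) (iter_residual_pod k.+1 Xw)).
  rewrite !iterS; reflexivity.
rewrite /van_cittert -(big_mkord xpredT (fun k => iter k residual F)).
rewrite (telescope_sumr_eq (fun k => - iter k residual w)) => [|//|k _].
  by rewrite opprK addrC.
by rewrite iterF opprK addrC.
Qed.

(** Testing the filter equation with [F] itself gives [|v - F|^2 = |v|^2 - 2 delta^2 |grad F|^2 -
    |F|^2]. *)
Lemma residual_contraction v : Xr v ->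
  dotL2 Om (residual v).1 (residual v).1 <= dotL2 Om v.1 v.1.
Proof.
move=> Xv; have [Lv _] := pod_space_L2 Xv.
have [XF FP] := rom_filterP delta Lv; have [LF _] := pod_space_L2 XF.
have := FP _ XF; rewrite /form /residual.
set F := rom_filter _ _ _ _ in XF LF *.
rewrite dotL2Br ?dotL2Bl//; last exact: is_L2B.
rewrite (dotL2C _ F.1 v.1).
have := dotL2_ge0 Om F.1; have := mulr_ge0 (sqr_ge0 delta) (dotL2_ge0 Om F.2).
move: (delta ^+ 2 * _) (dotL2 _ F.1 F.1) (dotL2 _ v.1 F.1) (dotL2 _ v.1 v.1).
by move=> *; lra.
Qed.

Lemma iter_residual_contraction k v : Xr v ->
  dotL2 Om (iter k residual v).1 (iter k residual v).1 <= dotL2 Om v.1 v.1.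
Proof.
move=> Xv; elim: k => //= k; apply: le_trans.
by apply: residual_contraction; exact: iter_residual_pod.
Qed.

Lemma residual_energy (u : h1pair R d) (L : 'rV[R]_d -> 'rV[R]_d) :
  is_L2 Om u.1 -> is_L2 Om u.2 -> is_L2 Om L ->
  (forall v, Xr v -> dotL2 Om L v.1 = - dotL2 Om u.2 v.2) ->
  dotL2 Om (residual (rom_proj Om Xr u.1)).1 (residual (rom_proj Om Xr u.1)).1 <=
    delta ^+ 2 * dotL2 Om (u - rom_proj Om Xr u.1).2 (u - rom_proj Om Xr u.1).2 +
    delta ^+ 4 * dotL2 Om L L.
Proof.
move=> L1 L2 LL LuL; set w := rom_proj _ _ _.
have [Xw _] := rom_projP L1; have [Lw1 Lw2] := pod_space_L2 Xw.
have [_ FP] := rom_filterP delta Lw1.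
have Xe := residual_pod Xw; have [Le1 Le2] := pod_space_L2 Xe.
have := FP _ Xe; rewrite /form.
(* With [F^r w = w - e] in the equation tested with [e], the term [(w, e)] cancels, leaving [|e|^2 =
   delta^2 ((grad w, grad e) - |grad e|^2)]. *)
have -> : rom_filter Om Xr delta w.1 = w - residual w.
  by rewrite /residual opprB addrC subrK.
rewrite (dotL2Bl mOm Lw1 Le1 Le1) (dotL2Bl mOm Lw2 Le2 Le2) => Feq.
(* The parameters carry the signs with which [(L, e)] and [(grad (u - w), grad e)] enter; the first
   also produces the factor [delta ^+ 4] of [|L|^2]. *)
have young1 := dotL2_young mOm (- delta ^+ 2) LL Le1.
have young2 := dotL2_young mOm (- 1) (is_L2B L2 Lw2) Le2.
rewrite h1_sndB; apply: (energy_estimate _ (LuL _ Xe) (dotL2Bl mOm L2 Lw2 Le2)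
  young1 young2 Feq).
exact: dotL2_ge0.
Qed.

Lemma van_cittert_error N (u : h1pair R d) (L : 'rV[R]_d -> 'rV[R]_d) :
  is_L2 Om u.1 -> is_L2 Om u.2 -> is_L2 Om L ->
  (forall v, Xr v -> dotL2 Om L v.1 = - dotL2 Om u.2 v.2) ->
  normL2 Om (u - van_cittert Om Xr delta N (rom_filter Om Xr delta u.1)).1 ^+ 2 <=
    2 * normL2 Om (u - rom_proj Om Xr u.1).1 ^+ 2 +
    2 * delta ^+ 2 * normL2 Om (u - rom_proj Om Xr u.1).2 ^+ 2 +
    2 * delta ^+ 4 * normL2 Om L ^+ 2.
Proof.
move=> L1 L2 LL LuL; have [Xw _] := rom_projP L1.
rewrite -(rom_filter_proj delta L1) (van_cittert_filter N Xw).
have := residual_energy L1 L2 LL LuL; set w := rom_proj _ _ _.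
have Xe := residual_pod Xw; have [Lw1 _] := pod_space_L2 Xw.
have [Lr _] := pod_space_L2 (iter_residual_pod N Xe).
(* The innermost residual carries the energy bound; the other [N] only contract, so the constants do
   not grow with [N]. *)
rewrite iterSr => energy.
apply: le_trans (sqr_normL2_error_split mOm L1 Lw1 Lr) _.
rewrite -addrA lerD2l -[2 * _ * _]mulrA -[2 * delta ^+ 4 * _]mulrA -mulrDr ler_pM2l//.
rewrite (sqr_normL2 Om (iter _ _ _).1).
apply: le_trans (iter_residual_contraction N Xe) _.
by rewrite (sqr_normL2 Om (u - w).2) (sqr_normL2 Om L).
Qed.

End deconvolution.

End reduced_order_model.

(** * Assembly of the error bound *)

Lemma spectral_norm_ge0 (R : realType) (n : nat) (A : 'M[R]_n) :
  0 <= spectral_norm A.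
Proof.
rewrite /spectral_norm; set S := [set _ | _ in _].
(* Without a supremum, [sup] takes its default value 0; otherwise the zero vector supplies a
   nonnegative member. *)
have [supS|/sup_out ->//] := pselect (has_sup S).
apply: (@le_trans _ _ (enorm (A *m (0 : 'cV[R]_n)))); first exact: sqrtr_ge0.
apply: (sup_upper_bound supS).
exists 0 => //=; rewrite /enorm big1 ?sqrtr0// => i _.
by rewrite big1// => j _; rewrite mxE expr0n.
Qed.

(** [C] may have either sign; passing to [|C|] keeps both bounds because [a] and [b] are
    nonnegative. *)
Lemma error_bound_collect (R : realFieldType) (C a b s t L X Y Z : R) :
  0 <= a -> 0 <= b -> 0 <= s -> 0 <= t -> 0 <= L ->
  X <= C * a -> Y <= C * b -> Z <= 2 * X + 2 * s * Y + 2 * t * L ->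
  Z <= (2 * `|C| + 2) * a + (2 * `|C| + 2) * s * b + (2 * `|C| + 2) * t * L.
Proof.
move=> a0 b0 s0 t0 L0 Xa Yb ZXYL.
have Ca := ler_wpM2r a0 (ler_norm C); have Cb := ler_wpM2r b0 (ler_norm C).
have sY := ler_wpM2l s0 (le_trans Yb Cb).
have sb := mulr_ge0 s0 b0; have tL := mulr_ge0 t0 L0.
have CtL := mulr_ge0 (normr_ge0 C) tL.
by move: `|C| Ca Cb sY CtL => c Ca Cb sY CtL; lra.
Qed.

Theorem lemma3p5 (R : realType) (d : nat) (hd : d = 2%N \/ d = 3%N)
    (* problem data *)
    (Om : set 'rV[R]_d) (hOm : bounded_domain Om)
    (T nu : R) (hT : 0 < T) (hnu : 0 < nu)
    (f : R -> 'rV[R]_d -> 'rV[R]_d)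
    (hf : forall t, 0 < t <= T -> is_L2 Om (f t))
    (C : R) (N : nat) :
  exists CN : R, 0 < CN /\
  forall (* exact solution *)
    (u : R -> h1pair R d) (p : R -> 'rV[R]_d -> R)
    (hup : weak_NSE_solution Om T nu f u p)
    (* finite element spaces and time discretization *)
    (m : nat) (hm : (1 <= m)%N)
    (Th : seq 'M[R]_(d.+1, d)) (h : R) (hTh : triangulation Om Th h)
    (Xh : set (h1pair R d)) (Qh : set ('rV[R]_d -> R))
    (hXQ : taylor_hood Om Th m Xh Qh)
    (K : nat) (dt : R) (hdt : 0 < dt) (hK : K%:R * dt = T)
    (* Laplacians of u at the times t_k = k dt *)
    (Lu : nat -> 'rV[R]_d -> 'rV[R]_d)
    (hLu : forall k, (k <= K)%N -> is_laplacian Om (u (k%:R * dt)) (Lu k))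
    (* snapshots and POD basis *)
    (uh : nat -> h1pair R d) (huh : forall k, (k <= K)%N -> Xh (uh k))
    (Rk : nat) (lam : nat -> R) (phi : nat -> h1pair R d)
    (hpod : pod_basis Om Xh K uh Rk lam phi)
    (r : nat) (hr : (r <= Rk)%N) (delta : R) (hdelta : 0 < delta),
  let Xr := pod_space phi r in
  let nS := spectral_norm (stiffness_mx Om phi r) in
  (forall k, (k <= K)%N ->
    let uk := u (k%:R * dt) in
    normL2 Om (uk - rom_proj Om Xr uk.1).1 ^+ 2
      <= C * (h ^+ (2 * m + 4) + dt ^+ 4 + \sum_(r <= j < Rk) lam j)) ->
  (forall k, (k <= K)%N ->
    let uk := u (k%:R * dt) in
    normL2 Om (uk - rom_proj Om Xr uk.1).2 ^+ 2
      <= C * (h ^+ (2 * m + 2) + nS * h ^+ (2 * m + 4) + (1 + nS) * dt ^+ 4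
              + \sum_(r <= j < Rk) normL2 Om (phi j).2 ^+ 2 * lam j)) ->
  forall k, (k <= K)%N ->
    let uk := u (k%:R * dt) in
    let ukbar := rom_filter Om Xr delta uk.1 in
    normL2 Om (uk - van_cittert Om Xr delta N ukbar).1 ^+ 2
      <= CN * (h ^+ (2 * m + 4) + dt ^+ 4 + \sum_(r <= j < Rk) lam j)
         + CN * delta ^+ 2 *
             (h ^+ (2 * m + 2) + nS * h ^+ (2 * m + 4) + (1 + nS) * dt ^+ 4
              + \sum_(r <= j < Rk) normL2 Om (phi j).2 ^+ 2 * lam j)
         + CN * delta ^+ 4 * normL2 Om (Lu k) ^+ 2.

Proof.
have mOm : measurable Om by apply: open_measurable_rV; case: hOm.
(* The factor 2 comes from splitting the error; the added 2 pays for the Laplacian term and keeps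
   the constant positive when [C] is 0. *)
exists (2 * `|C| + 2); split; first by rewrite ltr_wpDl// mulr_ge0.
move=> u p [uH _] m hm Th h hTh Xh Qh [XhE _] K dt hdt hK Lu hLu uh huh Rk lam phi.
move=> [_ [lam0 _ _] phiX phiO _] r hr delta hdelta Xr nS err1 err2 k kK.
cbv zeta; set uk := u (k%:R * dt).
have phiH j : (j < r)%N -> H10 Om (phi j).
  by move=> jr; have := phiX j (leq_trans jr hr); rewrite XhE => -[].
have phiL j : (j < r)%N -> is_L2 Om (phi j).1 /\ is_L2 Om (phi j).2.
  by move=> /phiH[].
have phiO' i j : (i < r)%N -> (j < r)%N ->
    dotL2 Om (phi i).1 (phi j).1 = (i == j)%:R.
  by move=> ir jr; apply: phiO; exact: leq_trans hr.
have [L1 L2 _] : H10 Om uk.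
  apply: uH; rewrite mulr_ge0 ?(ltW hdt)//= -hK ler_wpM2r ?(ltW hdt)//.
  by rewrite ler_nat.
have lapu : is_laplacian Om uk (Lu k) by exact: hLu.
(* Each mode lies in [Xh], hence in H^1_0, where integration by parts holds; linearity carries it to
   [Xr]. *)
have LuL v : Xr v -> dotL2 Om (Lu k) v.1 = - dotL2 Om uk.2 v.2.
  move=> [c ->]; rewrite comb_fst comb_snd (dotL2C _ (Lu k)) (dotL2C _ uk.2).
  have [LL _] := lapu.
  rewrite !dotL2_suml//; try by move=> i; have [] := phiL i (ltn_ord i).
  rewrite -sumrN; apply: eq_bigr => j _; rewrite -mulrN; congr (_ * _).
  by rewrite (dotL2C _ _ (Lu k)) (dotL2C _ _ uk.2); apply: dotL2_laplacian => //; exact: phiH.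
have := err2 k kK; have := err1 k kK; cbv zeta; rewrite -/uk -/Xr.
set a := _ + \sum_(r <= j < Rk) lam j; set b := _ + \sum_(r <= j < Rk) _ * _.
(* Nonnegativity of both brackets, required to replace [C] by [|C|]; the powers of [h] and [dt] are
   even. *)
have nS0 : 0 <= nS by exact: spectral_norm_ge0.
have h4 : 0 <= h ^+ (2 * m + 4) by rewrite exprn_even_ge0// oddD oddM.
have h2 : 0 <= h ^+ (2 * m + 2) by rewrite exprn_even_ge0// oddD oddM.
have dt4 : 0 <= dt ^+ 4 by rewrite exprn_even_ge0.
have lam_ge0 j : (r <= j < Rk)%N -> 0 <= lam j by move=> /andP[_ /lam0/ltW].
have a0 : 0 <= a.
  by rewrite !addr_ge0// big_nat sumr_ge0.
have b0 : 0 <= b.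
  have dtS := mulr_ge0 (addr_ge0 ler01 nS0) dt4; have hS := mulr_ge0 nS0 h4.
  rewrite !addr_ge0// big_nat sumr_ge0// => j /lam_ge0.
  exact/mulr_ge0/sqr_ge0.
have delta4 : 0 <= delta ^+ 4 by rewrite exprn_even_ge0.
move=> errX errY.
apply: (error_bound_collect a0 b0 (sqr_ge0 delta) delta4 (sqr_ge0 _) errX errY).
exact: (van_cittert_error mOm phiL phiO' delta N L1 L2 lapu.1 LuL).
Qed.
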